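(* For every constant $p\in(0,1)$ there are constants $c>0$ and $\epsilon_0>0$ such that for every $n\ge1$, every $\Delta>0$ and every $0<\epsilon\le\epsilon_0$ the following holds. Consider any quantum algorithm that, for every $\Delta$-gapped $n$-qubit Hamiltonian $\boldsymbol{H}$ with ground state $|\psi_0\rangle$ and every Hermitian observable $\boldsymbol{A}$ with $\|\boldsymbol{A}\|\le1$, given a single copy of $|\psi_0\rangle$ and black-box controlled forwards and backwards Hamiltonian evolution under $\boldsymbol{H}$, outputs an estimate of $\langle\psi_0|\boldsymbol{A}|\psi_0\rangle$ to within additive error $\epsilon$ with probability at least $p$. Then the algorithm must use (in the worst case over $\boldsymbol{H}$ and $\boldsymbol{A}$) total Hamiltonian evolution time at least $\dfrac{c}{\Delta\epsilon}$.
   Context: An $n$-qubit Hamiltonian $\boldsymbol{H}=\sum_{i=0}^{2^n-1}E_i|\psi_i\rangle\langle\psi_i|$ with $E_0\le E_1\le\cdots\le E_{2^n-1}$ is called $\Delta$-gapped if it has a unique ground state $|\psi_0\rangle$ and $E_1-E_0\ge\Delta$. The algorithm knows $\boldsymbol{A}$, but $\boldsymbol{H}$ is unknown and accessible only through the single copy of $|\psi_0\rangle$ and black-box uses of the controlled unitaries $e^{\pm i\boldsymbol{H}t}$ for times $t\ge0$ of its choice. Between uses it may apply arbitrary operations independent of $\boldsymbol{H}$, with arbitrary ancillas and adaptive measurements. The total Hamiltonian evolution time is the sum of the times $t$ over all uses of the black box. *)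

(* Defs.v *)
From HB Require Import structures.
From mathcomp Require Import all_boot all_order all_algebra.
From mathcomp Require Import complex mxtens.
From mathcomp Require Import all_classical all_reals all_analysis.

Set Implicit Arguments.
Unset Strict Implicit.
Unset Printing Implicit Defensive.

Import Order.TTheory GRing.Theory Num.Theory.
Import numFieldNormedType.Exports.

Local Open Scope classical_set_scope.
Local Open Scope sesquilinear_scope.
Local Open Scope complex_scope.
Local Open Scope ring_scope.

(* Vectors are columns; the bra of [v] is its conjugate transpose [v ^t*]. *)

(* Stated over an abstract numFieldType because that is the type on which
   mathcomp-analysis puts the topology of matrices; used below at [R[i]]. *)
Definition expmx (K : numFieldType) (d : nat) (M : 'M[K]_d) : 'M[K]_d :=
  limn (series (fun k : nat => (k`!%:R)^-1 *: M ^+ k)).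

(* [evolution H true t] is e^{iHt} and [evolution H false t] is e^{-iHt}. *)
Definition evolution (R : realType) (d : nat) (H : 'M[R[i]]_d)
    (forward : bool) (t : R) : 'M[R[i]]_d :=
  expmx (((if forward then t else - t)%:C * 'i) *: H).

Definition l2norm (R : realType) (d : nat) (v : 'cV[R[i]]_d) : R :=
  Num.sqrt (complex.Re ((v ^t* *m v) 0 0)).

Definition opnorm (R : realType) (d : nat) (A : 'M[R[i]]_d) : R :=
  sup [set l2norm (A *m v) | v in [set v | l2norm v <= 1]].

(* For Hermitian [A] this inner product is real, so [Re] loses nothing. *)
Definition expectation (R : realType) (d : nat) (A : 'M[R[i]]_d)
    (psi : 'cV[R[i]]_d) : R :=
  complex.Re ((psi ^t* *m A *m psi) 0 0).

Lemma exp2n_gt0 (n : nat) : (0 < 2 ^ n)%N.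
Proof. by rewrite expn_gt0. Qed.

Definition ord_ground (n : nat) : 'I_(2 ^ n) := Ordinal (exp2n_gt0 n).

Definition spectral_decomposition (R : realType) (n : nat)
    (H : 'M[R[i]]_(2 ^ n)) (E : 'I_(2 ^ n) -> R)
    (psi : 'I_(2 ^ n) -> 'cV[R[i]]_(2 ^ n)) : Prop :=
  [/\ forall j k, ((psi j) ^t* *m psi k) 0 0 = (j == k)%:R,
      H = \sum_j (E j)%:C *: (psi j *m (psi j) ^t* ) &
      forall j k : 'I_(2 ^ n), (j <= k)%N -> E j <= E k].

(* The clause on [j] with value 1 is the gap condition E_1 - E_0 >= Delta; the
   one before it says that the lowest eigenvalue is simple. *)
Definition gapped (R : realType) (n : nat) (Delta : R)
    (H : 'M[R[i]]_(2 ^ n)) (psi0 : 'cV[R[i]]_(2 ^ n)) : Prop :=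
  exists (E : 'I_(2 ^ n) -> R) (psi : 'I_(2 ^ n) -> 'cV[R[i]]_(2 ^ n)),
    [/\ spectral_decomposition H E psi,
        psi (ord_ground n) = psi0,
        forall j, j != ord_ground n -> E (ord_ground n) < E j &
        forall j : 'I_(2 ^ n), j = 1%N :> nat ->
          Delta <= E j - E (ord_ground n)].

(* A quantum instrument: outcome [x] turns the (subnormalized) state [rho] of
   dimension [d] into [\sum_(K <- kraus x) K *m rho *m K ^t*], of dimension
   [out_dim x].  Isometries adding ancillas, partial traces, channels and
   measurements are all of this form. *)
Record instrument (R : realType) (d : nat) := Instrument {
  outcomes : nat;
  out_dim : 'I_outcomes -> nat;
  kraus : forall x : 'I_outcomes, seq 'M[R[i]]_(out_dim x, d);
  kraus_complete : \sum_x \sum_(K <- kraus x) (K ^t* *m K) = 1%:M }.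

Definition apply_outcome (R : realType) (d : nat) (op : instrument R d)
    (x : 'I_(outcomes op)) (rho : 'M[R[i]]_d) : 'M[R[i]]_(out_dim x) :=
  \sum_(K <- kraus x) (K *m rho *m K ^t* ).

(* [algorithm R n d]: a strategy whose current quantum register has dimension
   [d].  It may stop and output an estimate, apply an instrument and go on in a
   way that depends on the outcome, or call the controlled evolution on a
   register (control qubit) (x) (n-qubit system) (x) (ancilla of dimension m).
   The type is coinductive, so the number of steps need not be bounded. *)
CoInductive algorithm (R : realType) (n : nat) : nat -> Type :=
| Output (d : nat) (a : R) : algorithm R n d
| Apply (d : nat) (op : instrument R d)
    (next : forall x : 'I_(outcomes op), algorithm R n (out_dim x)) :
    algorithm R n d
| Evolve (m : nat) (forward : bool) (t : R) (t_ge0 : 0 <= t)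
    (next : algorithm R n (2 * (2 ^ n * m))) :
    algorithm R n (2 * (2 ^ n * m)).

(* |0><0| (x) 1 (x) 1 + |1><1| (x) U (x) 1. *)
Definition controlled (R : realType) (n m : nat) (U : 'M[R[i]]_(2 ^ n)) :
    'M[R[i]]_(2 * (2 ^ n * m)) :=
  (delta_mx ord0 ord0 : 'M[R[i]]_2) *t (1%:M : 'M[R[i]]_(2 ^ n * m)) +
  (delta_mx ord_max ord_max : 'M[R[i]]_2) *t (U *t (1%:M : 'M[R[i]]_m)).

Definition evolve_state (R : realType) (n m : nat) (H : 'M[R[i]]_(2 ^ n))
    (forward : bool) (t : R) (rho : 'M[R[i]]_(2 * (2 ^ n * m))) :
    'M[R[i]]_(2 * (2 ^ n * m)) :=
  controlled m (evolution H forward t) *m rho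
    *m (controlled m (evolution H forward t)) ^t*.

(* The trace of a subnormalized state is the probability of the run so far. *)
Definition weight (R : realType) (d : nat) (rho : 'M[R[i]]_d) : R :=
  complex.Re (\tr rho).

(* Probability that, from the state [rho], the algorithm stops within [N] steps
   with an output in [S]. *)
Fixpoint output_prob_within (R : realType) (n : nat) (H : 'M[R[i]]_(2 ^ n))
    (S : set R) (N : nat) (d : nat) (alg : algorithm R n d) {struct N} :
    'M[R[i]]_d -> R :=
  if N is N'.+1 then
    match alg in algorithm _ _ d' return 'M[R[i]]_d' -> R with
    | Output _ a => fun rho => if a \in S then weight rho else 0
    | Apply _ op next => fun rho =>
        \sum_x output_prob_within H S N' (next x) (apply_outcome x rho)
    | Evolve _ forward t _ next => fun rho =>
        output_prob_within H S N' next (evolve_state H forward t rho)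
    end
  else fun=> 0.

Definition output_prob (R : realType) (n d : nat) (H : 'M[R[i]]_(2 ^ n))
    (S : set R) (alg : algorithm R n d) (rho : 'M[R[i]]_d) : R :=
  sup (range (fun N : nat => output_prob_within H S N alg rho)).

(* Largest total evolution time of the first [N] steps, over the runs of
   positive probability. *)
Fixpoint total_time_within (R : realType) (n : nat) (H : 'M[R[i]]_(2 ^ n))
    (N : nat) (d : nat) (alg : algorithm R n d) {struct N} : 'M[R[i]]_d -> R :=
  if N is N'.+1 then
    match alg in algorithm _ _ d' return 'M[R[i]]_d' -> R with
    | Output _ _ => fun=> 0
    | Apply _ op next => fun rho =>
        \big[Num.max/0]_(x | 0 < weight (apply_outcome x rho))
          total_time_within H N' (next x) (apply_outcome x rho)
    | Evolve _ forward t _ next => fun rho =>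
        t + total_time_within H N' next (evolve_state H forward t rho)
    end
  else fun=> 0.

Definition total_time (R : realType) (n d : nat) (H : 'M[R[i]]_(2 ^ n))
    (alg : algorithm R n d) (rho : 'M[R[i]]_d) : \bar R :=
  ereal_sup (range (fun N : nat => (total_time_within H N alg rho)%:E)).

(* The input register is the given copy of the ground state, so every algorithm
   for the task starts in dimension [2 ^ n].  It knows [A], hence is a function
   of [A]. *)
Definition estimates (R : realType) (n : nat) (Delta eps p : R)
    (alg : 'M[R[i]]_(2 ^ n) -> algorithm R n (2 ^ n)) : Prop :=
  forall (H : 'M[R[i]]_(2 ^ n)) (psi0 : 'cV[R[i]]_(2 ^ n))
    (A : 'M[R[i]]_(2 ^ n)),
    gapped Delta H psi0 -> A \is hermsymmx -> opnorm A <= 1 ->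
    p <= output_prob H [set a | `|a - expectation A psi0| <= eps]
           (alg A) (psi0 *m psi0 ^t* ).

(* Main.v *)
(* Hybrid argument.  Take H_x = Delta (1 - |psi_x><psi_x|), where psi_x is the
   basis vector e_0 rotated inside span(e_0, e_1) so that the Pauli matrix X on
   these two levels has expectation x.  Every H_x is Delta-gapped and
   e^{iH_x t} = 1 + (e^{i Delta t} - 1) (1 - |psi_x><psi_x|), which differs from
   e^{iH_0 t} by at most Delta t x in operator norm.  Hence an algorithm with
   total time T on H_0 sees H_0 and H_x within O(x + Delta T x).  Success with
   probability p on each of K > 2/p values x = 3 eps j, whose windows of
   acceptable estimates are disjoint, then forces T >= c / (Delta eps). *)

Require Import Defs.
From HB Require Import structures.
From mathcomp Require Import all_boot all_order all_algebra.
From mathcomp Require Import complex mxtens ring lra.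
From mathcomp Require Import all_classical all_reals all_analysis.

Import Order.TTheory GRing.Theory Num.Theory.
Import numFieldNormedType.Exports.

Local Open Scope classical_set_scope.
Local Open Scope sesquilinear_scope.
Local Open Scope complex_scope.
Local Open Scope ring_scope.

Set Implicit Arguments.
Unset Strict Implicit.
Unset Printing Implicit Defensive.

(** * The matrix exponential of a multiple of an idempotent *)

Lemma expmx_scale_idem (K : numFieldType) (d : nat) (z l : K) (Q : 'M[K]_d) :
  Q *m Q = Q ->
  (forall e : K, 0 < e ->
     \forall n \near \oo, `|l - series (fun k => z ^+ k / k`!%:R) n| < e) ->
  expmx (z *: Q) = 1%:M + (l - 1) *: Q.
Proof.
move=> QQ /cvgrPdist_lt cvl; apply: norm_cvg_lim.
have powQ k : (z *: Q) ^+ k.+1 = z ^+ k.+1 *: Q.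
  elim: k => [|k IH]; first by rewrite !expr1.
  by rewrite exprS IH -mulmxE -scalemxAl -scalemxAr QQ scalerA -exprS.
(* The term of index 0 is the identity and not a multiple of [Q]; the shift makes every partial sum
   contain it, so that it can be split off. *)
rewrite -cvg_shiftS.
have -> : (fun n => series (fun k => k`!%:R^-1 *: (z *: Q) ^+ k) n.+1) =
   (fun n => 1%:M +
      (series (fun k => z ^+ k / k`!%:R) n.+1 - 1) *: Q).
  apply/funext => n /=; rewrite !seriesEnat /= !big_nat_recl //=.
  rewrite !expr0 fact0 invr1 scale1r mul1r [(1 : K) + _]addrC addrK scaler_suml.
  congr (_ + _); apply: eq_bigr => k _.
  by rewrite powQ scalerA mulrC.
apply: cvgD; first exact: cvg_cst.
apply: cvgZr_tmp; apply: cvgB; last exact: cvg_cst.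
by rewrite -(cvg_shiftS (series _)) in cvl.
Qed.

(** * The scalar exponential on the imaginary axis *)

Section ComplexExponential.
Variable R : realType.
Implicit Types x : R.

Definition cis x : R[i] := cos x +i* sin x.

Lemma ReImP (z w : R[i]) :
  complex.Re z = complex.Re w -> complex.Im z = complex.Im w -> z = w.
Proof. by case: z w => [a b] [c d] /= -> ->. Qed.

Lemma cis_coeffE x k :
  (x%:C * 'i) ^+ k / k`!%:R = cos_coeff x k +i* sin_coeff x k.
Proof.
(* The powers of i are written in the shape of [cos_coeff] and [sin_coeff]: parity indicator times a
   sign. *)
have iE : ('i : R[i]) ^+ k =
    ((~~ odd k)%:R * (-1) ^+ k./2) +i* ((odd k)%:R * (-1) ^+ k.-1./2).
  elim: k => [|k IH]; first by rewrite expr0 /= !mul0r mul1r.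
  rewrite exprS IH; apply: ReImP => /=;
    case: k {IH} => [|k] /=; rewrite ?mul0r ?mul1r ?sub0r ?add0r ?oppr0 //;
    by case: (odd k); rewrite /= ?mul0r ?mul1r ?oppr0 ?exprS ?mulN1r.
have -> : (k`!%:R : R[i])^-1 = (k`!%:R^-1)%:C by rewrite fmorphV rmorph_nat.
rewrite exprMn iE -rmorphXn /= /cos_coeff /sin_coeff; apply: ReImP => /=;
  rewrite ?(mul0r, mulr0, subr0, addr0, add0r) -?exprnP; ring.
Qed.

(* Stated with epsilons because [R[i]] carries no canonical topology; a
   positive [e : R[i]] is real. *)
Lemma cvg_cis x (e : R[i]) : 0 < e ->
  \forall n \near \oo,
    `|cis x - series (fun k => (x%:C * 'i) ^+ k / k`!%:R) n| < e.
Proof.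
have serE n : series (fun k => (x%:C * 'i) ^+ k / k`!%:R) n =
    series (cos_coeff x) n +i* series (sin_coeff x) n.
  rewrite !seriesEnat /=; elim: n => [|n IH]; first by rewrite !big_geq.
  by rewrite !big_nat_recr //= IH cis_coeffE; apply: ReImP.
case: e => [e ie]; rewrite ltcE /= => /andP[/eqP -> e_gt0].
have e2 : 0 < e / 2 by rewrite divr_gt0.
have /cvgrPdist_lt /(_ _ e2) nc := is_cvg_series_cos_coeff (R := R) (x := x).
have /cvgrPdist_lt /(_ _ e2) ns := is_cvg_series_sin_coeff (R := R) (x := x).
near=> n; rewrite serE.
have hc : `|cos x - series (cos_coeff x) n| < e / 2.
  by rewrite cos.unlock; near: n.
have hs : `|sin x - series (sin_coeff x) n| < e / 2.
  by rewrite sin.unlock; near: n.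
set a := _ - _ in hc; set b := _ - _ in hs.
have -> : cis x - (series (cos_coeff x) n +i* series (sin_coeff x) n)
    = a%:C + b%:C * 'i by apply: ReImP => /=; rewrite /a /b; ring.
apply: (le_lt_trans (ler_normD _ _)); rewrite normrM.
have -> : `|'i : R[i]| = 1 by rewrite normc_def /= expr0n expr1n add0r sqrtr1.
rewrite mulr1 !normc_def /= expr0n !addr0 !sqrtr_sqr -rmorphD /=.
by rewrite ltcR (splitr e) ltrD.
Unshelve. all: by end_near.
Qed.

Lemma cis_conjM x : (cis x)^* * cis x = 1.
Proof.
apply: ReImP => /=; last by ring.
by rewrite mulNr opprK -!expr2 cos2Dsin2.
Qed.

(** Mean value theorem between 0 and [x], with |cos| at most 1; ordering the endpoints by [Num.min]
    and [Num.max] treats both signs of [x] at once. *)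
Lemma norm_sin_le x : `|sin x| <= `|x|.
Proof.
have D (y : R) : is_derive y 1 sin (cos y) by exact: is_derive_sin.
have le0x : Num.min 0 x <= Num.max 0 x by rewrite ge_min !le_max !lexx.
have [c _ E] := MVT_segment le0x (fun y _ => D y)
  (continuous_subspaceT (@continuous_sin R)).
have: `|sin (Num.max 0 x) - sin (Num.min 0 x)| <= `|x|.
  rewrite E normrM; apply: (le_trans (ler_wpM2r _ (cos_max _))) => //.
  by rewrite mul1r; case: (leP 0 x) => _; rewrite ?subr0 ?sub0r ?normrN.
by case: (leP 0 x) => _; rewrite sin0 ?subr0 ?sub0r ?normrN.
Qed.

(** The squared chord from 1 to e^{ix} on the unit circle, by the doubling formulas at x/2. *)
Lemma cis_sub1_normsq x :
  (cis x - 1)^* * (cis x - 1) = ((2 * sin (x / 2)) ^+ 2)%:C.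
Proof.
have -> : cis x = cis (x / 2 *+ 2) by rewrite -mulr_natr divfK.
rewrite /cis cos_mulr2n sin_mulr2n; set y := x / 2.
have := cos2Dsin2 y; move: (cos y) (sin y) => a b ab.
have -> : a ^+ 2 = 1 - b ^+ 2 by rewrite -ab addrK.
apply: ReImP => /=; last by ring.
have aE : a ^+ 2 = 1 - b ^+ 2 by rewrite -ab addrK.
transitivity (4 * (b^+2)^+2 + 4 * (a^+2 * b^+2)); first ring.
rewrite aE; ring.
Qed.

End ComplexExponential.

(** * Positive semidefinite matrices, traces and perturbed conjugations *)

Section PositiveSemidefinite.
Variable R : realType.
Local Notation C := R[i].

Lemma adjmxM m n p (A : 'M[C]_(m, n)) (B : 'M[C]_(n, p)) :
  (A *m B)^t* = B^t* *m A^t*.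
Proof. by rewrite trmx_mul map_mxM. Qed.

Lemma adjmxD m n (A B : 'M[C]_(m, n)) : (A + B)^t* = A^t* + B^t*.
Proof. by rewrite linearD /= map_mxD. Qed.

Lemma adjmxN m n (A : 'M[C]_(m, n)) : (- A)^t* = - A^t*.
Proof. by rewrite linearN /= map_mxN. Qed.

Lemma adjmxZ m n (a : C) (A : 'M[C]_(m, n)) : (a *: A)^t* = a^* *: A^t*.
Proof. by rewrite linearZ /= map_mxZ. Qed.

Lemma conj_realC (x : R) : Num.conj (x%:C : C) = x%:C.
Proof. exact: conjc_real. Qed.

Lemma adjmx1 n : (1%:M : 'M[C]_n)^t* = 1%:M.
Proof. by rewrite trmx1 map_mx1. Qed.

(** In [R[i]], [0 <= z] also says that [z] is real, so Hermiticity is included. *)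
Definition psd d (M : 'M[C]_d) : Prop :=
  forall v : 'cV[C]_d, 0 <= (v^t* *m M *m v) 0 0.

Lemma psd0 d : psd (0 : 'M[C]_d).
Proof. by move=> v; rewrite mulmx0 mul0mx mxE. Qed.

Lemma psdD d (M N : 'M[C]_d) : psd M -> psd N -> psd (M + N).
Proof. by move=> pM pN v; rewrite mulmxDr mulmxDl mxE addr_ge0. Qed.

Lemma psdZ d (a : C) (M : 'M[C]_d) : 0 <= a -> psd M -> psd (a *: M).
Proof. by move=> a0 pM v; rewrite -scalemxAr -scalemxAl mxE mulr_ge0. Qed.

Lemma psd_conj m n (K : 'M[C]_(m, n)) (M : 'M[C]_n) :
  psd M -> psd (K *m M *m K^t*).
Proof.
by move=> pM v; have := pM (K^t* *m v); rewrite adjmxM trmxCK !mulmxA.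
Qed.

Lemma psd1 d : psd (1%:M : 'M[C]_d).
Proof.
move=> v; rewrite mulmx1 mxE sumr_ge0 // => k _.
by rewrite !mxE mulrC mul_conjC_ge0.
Qed.

Lemma psd_gram m n (K : 'M[C]_(m, n)) : psd (K *m K^t*).
Proof. by rewrite -{1}[K]mulmx1; exact/psd_conj/psd1. Qed.

Lemma psd_sum d I (r : seq I) (F : I -> 'M[C]_d) :
  (forall i, psd (F i)) -> psd (\sum_(i <- r) F i).
Proof.
move=> pF; elim: r => [|i r IH]; rewrite ?big_nil ?big_cons.
  exact: psd0.
exact (psdD (pF i) IH).
Qed.

Lemma psd_trace_ge0 d (M : 'M[C]_d) : psd M -> 0 <= \tr M.
Proof.
move=> pM; rewrite /mxtrace sumr_ge0 // => k _.
have := pM (delta_mx k 0); rewrite trmx_delta map_delta_mx -rowE -colE.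
by rewrite !mxE.
Qed.

Lemma weightD d (M N : 'M[C]_d) : weight (M + N) = weight M + weight N.
Proof. by rewrite /weight mxtraceD raddfD. Qed.

Lemma weightN d (M : 'M[C]_d) : weight (- M) = - weight M.
Proof. by rewrite /weight raddfN raddfN. Qed.

Lemma weightZ d (a : R) (M : 'M[C]_d) : weight (a%:C *: M) = a * weight M.
Proof. by rewrite /weight mxtraceZ; case: (\tr M) => x y /=; rewrite mul0r subr0. Qed.

Lemma weight_mulC m n (A : 'M[C]_(m, n)) (B : 'M[C]_(n, m)) :
  weight (A *m B) = weight (B *m A).
Proof. by rewrite /weight mxtrace_mulC. Qed.

Lemma weight_ge0 d (M : 'M[C]_d) : psd M -> 0 <= weight M.
Proof. by move=> /psd_trace_ge0; rewrite /weight lecE => /andP[]. Qed.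

Lemma weight_unitary d (U M : 'M[C]_d) :
  U \is unitarymx -> weight (U *m M *m U^t*) = weight M.
Proof.
by move=> /unitarymxP /mulmx1C UU; rewrite weight_mulC mulmxA UU mul1mx.
Qed.

Definition orthoproj d (P : 'M[C]_d) : Prop := P^t* = P /\ P *m P = P.

Lemma orthoproj_psd d (P : 'M[C]_d) : orthoproj P -> psd P.
Proof. by case=> Ph PP; rewrite -PP -{2}Ph; exact: psd_gram. Qed.

Lemma orthoproj_compl d (P : 'M[C]_d) : orthoproj P -> orthoproj (1%:M - P).
Proof.
case=> Ph PP; split; first by rewrite adjmxD adjmxN adjmx1 Ph.
by rewrite mulmxBr mulmx1 mulmxBl mul1mx PP subrr subr0.
Qed.

(** By cyclicity of the trace, the difference of the two sides is the weight of (1 - P) M (1 -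
    P). *)
Lemma weight_orthoproj_le d (P M : 'M[C]_d) : orthoproj P -> psd M ->
  weight (P *m M) <= weight M.
Proof.
move=> oP pM; have [Qh QQ] := orthoproj_compl oP.
have := weight_ge0 (psd_conj (1%:M - P) pM).
rewrite Qh weight_mulC mulmxA QQ mulmxBl mul1mx.
by rewrite weightD weightN subr_ge0.
Qed.

(** The diagonal entries of the product are the sums of squared moduli over the columns of [D]. *)
Lemma mul_adjmx_eq0 m n (D : 'M[C]_(m, n)) : D^t* *m D = 0 -> D = 0.
Proof.
move=> D0; apply/matrixP => i j; rewrite [RHS]mxE.
have /matrixP /(_ j j) := D0; rewrite !mxE => /psumr_eq0P S0.
apply/eqP; rewrite -mul_conjC_eq0; apply/eqP.
by have := S0 _ i isT; rewrite !mxE mulrC; apply => k _; rewrite !mxE mulrC mul_conjC_ge0.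
Qed.

(* With [s > 0] the difference is [s^-1 (s U - D) rho (s U - D)^*], so that
   no trace norm is needed. *)
Lemma perturbed_conj_le d (U D rho P : 'M[C]_d) (s : R) :
  0 <= s -> psd rho -> U \is unitarymx -> orthoproj P ->
  D^t* *m D = (s ^+ 2)%:C *: P ->
  exists Q : 'M[C]_d,
    [/\ psd Q, weight Q <= (2 * s + s ^+ 2) * weight rho &
        psd (U *m rho *m U^t* + Q - (U + D) *m rho *m (U + D)^t*)].
Proof.
(* The general witness divides by [s]; for [s = 0] the hypothesis forces [D = 0]. *)
move=> s_ge0 prho uU oP DD; have [s0|s_neq0] := eqVneq s 0.
  have -> : D = 0 by apply: mul_adjmx_eq0; rewrite DD s0 expr0n scale0r.
  exists 0; split; first exact: psd0.
    by rewrite s0 mulr0 expr0n addr0 mul0r /weight mxtrace0.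
  by rewrite !addr0 subrr; exact: psd0.
have s_gt0 : 0 < s by rewrite lt_def s_neq0.
have sC_neq0 : s%:C != 0 by rewrite fmorph_eq0.
(* The coefficients complete the square against the cross terms of [U] and [D]. As the [D] conjugate
   weighs at most s^2 [weight rho], the cost is s + (1 + 1/s) s^2 = 2 s + s^2. *)
exists (s%:C *: (U *m rho *m U^t*) + (1 + s^-1)%:C *: (D *m rho *m D^t*)); split.
- have s1 : (0 : C) <= (1 + s^-1)%:C by rewrite lecR addr_ge0 ?invr_ge0.
  have s2 : (0 : C) <= s%:C by rewrite lecR.
  exact (psdD (psdZ s2 (psd_conj U prho)) (psdZ s1 (psd_conj D prho))).
- have wD : weight (D *m rho *m D^t*) <= s ^+ 2 * weight rho.
    rewrite weight_mulC mulmxA DD -scalemxAl weightZ.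
    by rewrite ler_wpM2l ?sqr_ge0 // weight_orthoproj_le.
  rewrite weightD !weightZ weight_unitary //.
  have := ler_wpM2l (_ : 0 <= 1 + s^-1) wD.
  rewrite addr_ge0 ?invr_ge0 // => /(_ isT) H.
  rewrite (le_trans (lerD (lexx _) H)) // le_eqVlt; apply/orP; left.
  by apply/eqP; field.
- have -> : U *m rho *m U^t* + (s%:C *: (U *m rho *m U^t*)
      + (1 + s^-1)%:C *: (D *m rho *m D^t*)) - (U + D) *m rho *m (U + D)^t*
      = (s^-1)%:C *: ((s%:C *: U - D) *m rho *m (s%:C *: U - D)^t*).
    rewrite !(adjmxD, adjmxN, adjmxZ, mulmxDl, mulmxDr, mulNmx, mulmxN).
    rewrite conj_realC -!(scalemxAl, scalemxAr).
    move: (U *m rho *m U^t*) (D *m rho *m D^t*) (U *m rho *m D^t*) (D *m rho *m U^t*).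
    move=> A B X Y; apply/matrixP => i j; rewrite !mxE.
    rewrite rmorphD rmorph1 fmorphV /=; field.
    exact: sC_neq0.
  by apply: psdZ; [rewrite lecR invr_ge0 | exact: psd_conj].
Qed.

(** Triangle inequality for one-sided domination: the error of the present step adds to the old
    error carried through [V]. *)
Lemma psd_conj_trans d (V A Q1 rho Q rho' : 'M[C]_d) :
  psd (A + Q1 - V *m rho *m V^t*) -> psd (rho + Q - rho') ->
  psd (A + (Q1 + V *m Q *m V^t*) - V *m rho' *m V^t*).
Proof.
move=> p1 p2; have := psdD p1 (psd_conj V p2).
rewrite mulmxBr mulmxDr mulmxBl mulmxDl.
move: (V *m rho *m _) (V *m Q *m _) (V *m rho' *m _) => X Y Z.
congr psd; apply/matrixP => i j; rewrite !mxE; ring.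
Qed.

End PositiveSemidefinite.

(** * Controlled unitaries *)

Section Controlled.
Variable R : realType.
Local Notation C := R[i].

(** The block of [controlled] with the control at 1, for arbitrary [X]: the difference of two
    controlled evolutions is such a lift, although not unitary. *)
Definition ctrl_lift (n m : nat) (X : 'M[C]_(2 ^ n)) : 'M[C]_(2 * (2 ^ n * m)) :=
  (delta_mx ord_max ord_max : 'M[C]_2) *t (X *t (1%:M : 'M[C]_m)).

Lemma adjmx_tens m n p q (A : 'M[C]_(m, n)) (B : 'M[C]_(p, q)) :
  (A *t B)^t* = A^t* *t B^t*.
Proof. by rewrite trmx_tens map_mxT. Qed.

Lemma tensmxDl m n p q (A A' : 'M[C]_(m, n)) (B : 'M[C]_(p, q)) :
  (A + A') *t B = A *t B + A' *t B.
Proof.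
by apply/matrixP => i j; rewrite !mxE mulrDl.
Qed.

Lemma tensmx1 m n : (1%:M : 'M[C]_m) *t (1%:M : 'M[C]_n) = 1%:M.
Proof.
apply/matrixP => i j; case: (mxtens_indexP i) => i0 i1.
case: (mxtens_indexP j) => j0 j1; rewrite tensmxE !mxE -natrM mulnb.
by rewrite (can_eq (@mxtens_indexK _ _)).
Qed.

Lemma ctrl_liftM n m (A B : 'M[C]_(2 ^ n)) :
  ctrl_lift m A *m ctrl_lift m B = ctrl_lift m (A *m B).
Proof. by rewrite /ctrl_lift !tensmx_mul mul_delta_mx mulmx1. Qed.

Lemma adjmx_ctrl_lift n m (A : 'M[C]_(2 ^ n)) :
  (ctrl_lift m A)^t* = ctrl_lift m (A^t* ).
Proof. by rewrite /ctrl_lift !adjmx_tens trmx_delta map_delta_mx adjmx1. Qed.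

Lemma ctrl_liftZ n m a (A : 'M[C]_(2 ^ n)) :
  ctrl_lift m (a *: A) = a *: ctrl_lift m A.
Proof.
by apply/matrixP => i j; rewrite !mxE; ring.
Qed.

Lemma controlledE n m (U : 'M[C]_(2 ^ n)) :
  controlled m U = (delta_mx ord0 ord0 : 'M[C]_2) *t 1%:M + ctrl_lift m U.
Proof. by []. Qed.

Lemma controlled_diff n m (U V : 'M[C]_(2 ^ n)) :
  controlled m V = controlled m U + ctrl_lift m (V - U).
Proof.
by apply/matrixP => i j; rewrite !mxE; ring.
Qed.

(** The two blocks live on orthogonal control states, so the cross terms vanish and |0><0| + |1><1|
    = 1 remains on the control. *)
Lemma controlled_unitary n m (U : 'M[C]_(2 ^ n)) :
  U \is unitarymx -> controlled m U \is unitarymx.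
Proof.
move=> /unitarymxP UU; apply/unitarymxP; rewrite controlledE.
rewrite adjmxD adjmx_ctrl_lift mulmxDl !mulmxDr ctrl_liftM UU.
rewrite adjmx_tens trmx_delta map_delta_mx adjmx1 /ctrl_lift !tensmx_mul.
rewrite !mul_delta_mx_cond /= !mulr0n !tens0mx add0r addr0 !mulr1n mulmx1.
rewrite tensmx1 -tensmxDl; set E := _ + _.
have -> : E = 1%:M.
  apply/matrixP => i j; rewrite !mxE.
  by case: i => [[|[|//]]] ?; case: j => [[|[|//]]] ?; rewrite /= ?addr0 ?add0r.
exact: tensmx1.
Qed.

Lemma orthoproj_ctrl_lift n m (P : 'M[C]_(2 ^ n)) :
  orthoproj P -> orthoproj (ctrl_lift m P).
Proof. by case=> Ph PP; split; rewrite ?adjmx_ctrl_lift ?ctrl_liftM ?Ph ?PP. Qed.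

End Controlled.

(** * Instruments preserve positivity and total weight *)

Section Instruments.
Variable R : realType.
Local Notation C := R[i].

Lemma apply_outcome_psd d (op : instrument R d) x (rho : 'M[C]_d) :
  psd rho -> psd (apply_outcome (op := op) x rho).
Proof. by move=> prho; apply: psd_sum => K; exact: psd_conj. Qed.

Lemma apply_outcomeD d (op : instrument R d) x (rho sigma : 'M[C]_d) :
  apply_outcome (op := op) x (rho + sigma) =
  apply_outcome x rho + apply_outcome x sigma.
Proof.
rewrite /apply_outcome -big_split; apply: eq_bigr => K _.
by rewrite mulmxDr mulmxDl.
Qed.

Lemma apply_outcomeN d (op : instrument R d) x (rho : 'M[C]_d) :
  apply_outcome (op := op) x (- rho) = - apply_outcome x rho.
Proof.
rewrite /apply_outcome -sumrN; apply: eq_bigr => K _.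
by rewrite mulmxN mulNmx.
Qed.

Lemma weight_sum d I (r : seq I) (F : I -> 'M[C]_d) :
  weight (\sum_(i <- r) F i) = \sum_(i <- r) weight (F i).
Proof.
by apply: big_morph; [exact: weightD | rewrite /weight mxtrace0].
Qed.

Lemma sum_weight_apply_outcome d (op : instrument R d) (rho : 'M[C]_d) :
  \sum_x weight (apply_outcome (op := op) x rho) = weight rho.
Proof.
rewrite -[in RHS](mul1mx rho) -(kraus_complete op) mulmx_suml weight_sum.
apply: eq_bigr => x _; rewrite mulmx_suml /apply_outcome !weight_sum.
by apply: eq_bigr => K _; rewrite weight_mulC mulmxA.
Qed.

Lemma evolve_state_psd n m (H : 'M[C]_(2 ^ n)) b t rho :
  psd rho -> psd (evolve_state (m := m) H b t rho).
Proof. exact: psd_conj. Qed.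

End Instruments.

(** * The hybrid argument for adaptive algorithms *)

Section Hybrid.
Variables (R : realType) (n : nat).
Local Notation C := R[i].
Implicit Types (H : 'M[C]_(2 ^ n)) (S : set R).

(** A hypothesis of the hybrid argument; it is established for the rotated Hamiltonians, whose
    exponential is explicit. *)
Definition unitary_evolution H : Prop :=
  forall b t, evolution H b t \is unitarymx.

Lemma weight_evolve_state m H b t (rho : 'M[C]_(2 * (2 ^ n * m))) :
  unitary_evolution H -> weight (evolve_state H b t rho) = weight rho.
Proof. by move=> uH; rewrite weight_unitary // controlled_unitary. Qed.

Lemma output_prob_within_ge0 H S N d (alg : algorithm R n d) rho :
  psd rho -> 0 <= output_prob_within H S N alg rho.
Proof.
elim: N d alg rho => [//|N IH] d; case=> {d}
  [d a|d op next|m b t t0 next] rho prho /=.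
- by case: ifP => // _; exact: weight_ge0.
- by apply: sumr_ge0 => x _; apply: IH; exact: apply_outcome_psd.
- by apply: IH; exact: evolve_state_psd.
Qed.

Lemma output_prob_within_nondecreasing H S N N' d (alg : algorithm R n d) rho :
  psd rho -> (N <= N')%N ->
  output_prob_within H S N alg rho <= output_prob_within H S N' alg rho.
Proof.
elim: N N' d alg rho => [|N IH] N' d alg rho prho.
  by move=> _; exact: output_prob_within_ge0.
case: N' => // N'; rewrite ltnS => leN.
case: d / alg rho prho => [d a|d op next|m b t t0 next] rho prho //=.
- by apply: ler_sum => x _; apply: IH => //; exact: apply_outcome_psd.
- by apply: IH => //; exact: evolve_state_psd.
Qed.

(** Stopping in different [S i] are exclusive events: a leaf of the run contributes to at most one
    [i], and the other steps preserve total weight. *)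
Lemma sum_output_prob_within_le H (I : finType) (S : I -> set R) N d
    (alg : algorithm R n d) rho :
  unitary_evolution H -> (forall i j a, S i a -> S j a -> i = j) ->
  psd rho -> \sum_i output_prob_within H (S i) N alg rho <= weight rho.
Proof.
move=> uH disjS; elim: N d alg rho => [|N IH] d alg rho prho.
  by rewrite big1 // weight_ge0.
case: d / alg rho prho => [d a|d op next|m b t t0 next] rho prho /=.
- have [/existsP[i Sia]|/existsPn noS] := boolP [exists i, a \in S i].
    rewrite (bigD1 i) //= Sia big1 ?addr0 // => j ji.
    case: ifP => // Sja; move: ji; rewrite (disjS j i a) ?eqxx //.
      by move: Sja; rewrite inE.
    by move: Sia; rewrite inE.
  by rewrite big1 ?weight_ge0 // => i _; rewrite (negbTE (noS i)).
- rewrite exchange_big /= -(sum_weight_apply_outcome op).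
  by apply: ler_sum => x _; apply: IH; exact: apply_outcome_psd.
- rewrite -(weight_evolve_state b t rho uH).
  by apply: IH; exact: evolve_state_psd.
Qed.

Lemma output_prob_within_le_weight H S N d (alg : algorithm R n d) rho :
  unitary_evolution H -> psd rho ->
  output_prob_within H S N alg rho <= weight rho.
Proof.
move=> uH prho; have := @sum_output_prob_within_le H 'I_1 (fun=> S) N d alg rho uH.
by rewrite big_ord1; apply => // i j *; rewrite (ord1 i) (ord1 j).
Qed.

Lemma total_time_within_ge0 H N d (alg : algorithm R n d) rho :
  0 <= total_time_within H N alg rho.
Proof.
elim: N d alg rho => [//|N IH] d; case=> {d}
  [d a|d op next|m b t t0 next] rho //=.
- by elim/big_ind: _ => // x y x0 y0; rewrite le_max x0.
- by rewrite addr_ge0.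
Qed.

(** An operator-norm bound linear in time, encoded by the identity that [perturbed_conj_le]
    consumes. One [P] serves all times and both directions. *)
Definition evolution_distance_le (kappa : R) (P H H' : 'M[C]_(2 ^ n)) : Prop :=
  forall b t, 0 <= t -> exists s, [/\ 0 <= s, s <= kappa * t &
    (evolution H' b t - evolution H b t)^t* *m
      (evolution H' b t - evolution H b t) = (s ^+ 2)%:C *: P].

(* [Q] is a one-sided substitute for the trace distance of [rho] and [rho'].
   Only [H]-runs of positive probability have a time bound; on the others [rho]
   has weight 0 and [Q] dominates [rho'].  The factor 3 comes from
   [2 s + s ^+ 2 <= 3 s] for [s <= 1]. *)
Lemma output_prob_within_hybrid H H' P kappa S N d (alg : algorithm R n d)
    rho rho' Q B :
  unitary_evolution H -> unitary_evolution H' -> orthoproj P ->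
  0 <= kappa -> evolution_distance_le kappa P H H' ->
  psd rho -> psd rho' -> psd Q -> psd (rho + Q - rho') ->
  kappa * B <= 1 -> total_time_within H N alg rho <= B ->
  output_prob_within H' S N alg rho' <=
    output_prob_within H S N alg rho + weight Q + 3 * (kappa * B) * weight rho.
Proof.
move=> uH uH' oP k0 HH'.
elim: N d alg rho rho' Q B => [|N IH] d alg rho rho' Q B prho prho' pQ pd kB TB.
  by rewrite /= add0r addr_ge0 ?mulr_ge0 ?weight_ge0.
have wle : weight rho' <= weight rho + weight Q.
  by have := weight_ge0 pd; rewrite weightD weightN weightD subr_ge0.
have B0 : 0 <= B by exact: le_trans (total_time_within_ge0 _ _ _ _) TB.
have kB0 : 0 <= kappa * B by exact: mulr_ge0.
case: d / alg rho rho' Q prho prho' pQ pd TB wle =>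
  [d a|d op next|m b t t0 next] rho rho' Q prho prho' pQ pd TB wle.
- have rest0 : 0 <= 3 * (kappa * B) * weight rho.
    by rewrite !mulr_ge0 ?weight_ge0.
  rewrite /=; case: ifP => _; first by rewrite (le_trans wle) // lerDl.
  by rewrite add0r addr_ge0 // weight_ge0.
- rewrite /= -(sum_weight_apply_outcome op Q) -(sum_weight_apply_outcome op rho).
  rewrite mulr_sumr -!big_split /=; apply: ler_sum => x _.
  have p1 := apply_outcome_psd (x := x) prho; have p2 := apply_outcome_psd (x := x) prho'.
  have p3 := apply_outcome_psd (x := x) pQ; have p4 := apply_outcome_psd (x := x) pd.
  rewrite apply_outcomeD apply_outcomeN apply_outcomeD in p4.
  (* An outcome of positive weight enters the maximum in [total_time_within], so its continuation
     inherits the budget [B]. Otherwise the continuation is bounded by its whole weight, which [Q]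
     pays for. *)
  have [wx|wx] := ltP 0 (weight (apply_outcome x rho)).
    apply: IH => //; apply: le_trans TB => /=.
    exact: (le_bigmax_cond _
      (fun x => total_time_within H N (next x) (apply_outcome x rho)) wx).
  have wx0 : weight (apply_outcome x rho) = 0.
    by apply/le_anti; rewrite wx weight_ge0.
  rewrite wx0 mulr0 addr0 (le_trans (output_prob_within_le_weight _ _ _ _ _)) //.
  have := weight_ge0 p4; rewrite weightD weightN weightD subr_ge0 wx0 add0r.
  by move=> /le_trans; apply; rewrite lerDr output_prob_within_ge0.
- rewrite /= in TB *.
  have tB : t <= B.
    by apply: le_trans TB; rewrite lerDl total_time_within_ge0.
  have [s [s0 st DD]] := HH' b t t0.
  set U := controlled m (evolution H b t).
  set U' := controlled m (evolution H' b t).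
  have UDU : U' = U + ctrl_lift m (evolution H' b t - evolution H b t).
    exact (controlled_diff m _ _).
  have uU : U \is unitarymx by rewrite controlled_unitary //; exact: uH.
  have lDD : (ctrl_lift m (evolution H' b t - evolution H b t))^t* *m
      ctrl_lift m (evolution H' b t - evolution H b t)
      = (s ^+ 2)%:C *: ctrl_lift m P.
    by rewrite adjmx_ctrl_lift ctrl_liftM DD ctrl_liftZ.
  have [Q1 [pQ1 wQ1 dQ1]] :=
    perturbed_conj_le s0 prho uU (orthoproj_ctrl_lift m oP) lDD.
  rewrite -UDU in dQ1.
  (* The new error is that of this call plus the old one evolved under [H']; the remaining budget is
     [B - t]. *)
  have pd' : psd (evolve_state H b t rho + (Q1 + evolve_state H' b t Q)
                  - evolve_state H' b t rho').
    exact (psd_conj_trans dQ1 pd).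
  have kB' : kappa * (B - t) <= 1.
    by rewrite (le_trans _ kB) // ler_wpM2l // gerBl.
  have TB' : total_time_within H N next (evolve_state H b t rho) <= B - t.
    by rewrite lerBrDl.
  have := IH _ next (evolve_state H b t rho) (evolve_state H' b t rho')
    (Q1 + evolve_state H' b t Q) (B - t) (evolve_state_psd H b t prho)
    (evolve_state_psd H' b t prho') (psdD pQ1 (evolve_state_psd H' b t pQ))
    pd' kB' TB'.
  move=> /le_trans; apply.
  have w0 := weight_ge0 prho; have s1 : s <= 1.
    by rewrite (le_trans st) // (le_trans _ kB) // ler_wpM2l.
  (* This call costs at most 3 s <= 3 kappa t, exactly what the bound loses when [B] becomes
     [B - t]. *)
  have ss : 2 * s + s ^+ 2 + 3 * (kappa * (B - t)) <= 3 * (kappa * B) by nra.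
  have := ler_wpM2r w0 ss; move: wQ1.
  have := weightD Q1 (evolve_state H' b t Q).
  have := weight_evolve_state b t rho uH; have := weight_evolve_state b t Q uH'.
  move: (evolve_state H b t rho) (evolve_state H' b t Q) => X Y -> -> ->.
  by lra.
Qed.

End Hybrid.

(** * Two-level algebra over a commutative ring *)

Section LevelAlgebra.
Variables (K : comNzRingType) (d : nat) (i0 i1 : 'I_d).
Hypothesis i01 : i0 != i1.
Local Notation E i j := (delta_mx i j : 'M[K]_d).

Definition level_proj : 'M[K]_d := E i0 i0 + E i1 i1.

(* The reflection [[a, b], [b, -a]] on the span of the basis vectors [i0] and
   [i1], zero elsewhere. *)
Definition level_refl (a b : K) : 'M[K]_d :=
  a *: (E i0 i0 - E i1 i1) + b *: (E i0 i1 + E i1 i0).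

Lemma level_neqE : (i0 == i1 = false) * (i1 == i0 = false).
Proof. by split; [|rewrite eq_sym]; exact: negbTE. Qed.

Lemma level_projM : level_proj *m level_proj = level_proj.
Proof.
rewrite /level_proj !(mulmxDl, mulmxDr) !mul_delta_mx_cond !eqxx !level_neqE.
by rewrite !mulr1n !mulr0n addr0 add0r.
Qed.

Lemma level_refl_sq a b : a ^+ 2 + b ^+ 2 = 1 ->
  level_refl a b *m level_refl a b = level_proj.
Proof.
move=> ab; rewrite /level_refl /level_proj.
rewrite !(mulmxDl, mulmxDr, mulmxN, mulNmx) -!(scalemxAl, scalemxAr).
rewrite !(mulmxDl, mulmxDr, mulmxN, mulNmx) !mul_delta_mx_cond !eqxx !level_neqE.
rewrite !mulr1n !mulr0n -[in RHS](scale1r (_ + _)) -ab.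
move: (E i0 i0) (E i0 i1) (E i1 i0) (E i1 i1) => A B D F.
by apply/matrixP => i j; rewrite !mxE; ring.
Qed.

Lemma level_proj_refl a b : level_proj *m level_refl a b = level_refl a b.
Proof.
rewrite /level_proj /level_refl !(mulmxDl, mulmxDr, mulmxN) -!scalemxAr.
rewrite !(mulmxDr, mulmxN) !mul_delta_mx_cond !eqxx !level_neqE !mulr1n !mulr0n.
move: (E i0 i0) (E i0 i1) (E i1 i0) (E i1 i1) => A B D F.
by apply/matrixP => i j; rewrite !mxE; ring.
Qed.

Lemma level_refl_proj a b : level_refl a b *m level_proj = level_refl a b.
Proof.
rewrite /level_proj /level_refl !(mulmxDl, mulmxDr, mulNmx) -!scalemxAl.
rewrite !(mulmxDl, mulNmx) !mul_delta_mx_cond !eqxx !level_neqE !mulr1n !mulr0n.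
move: (E i0 i0) (E i0 i1) (E i1 i0) (E i1 i1) => A B D F.
by apply/matrixP => i j; rewrite !mxE; ring.
Qed.

Definition rotated_state (c s : K) : 'cV[K]_d :=
  c *: delta_mx i0 0 + s *: delta_mx i1 0.

Lemma trmx_rotated_state c s :
  (rotated_state c s)^T = c *: delta_mx 0 i0 + s *: delta_mx 0 i1.
Proof. by rewrite /rotated_state linearD /= !linearZ /= !trmx_delta. Qed.

(** The transpose stands in for the adjoint, as [K] has no conjugation; for real parameters they
    agree by [adjmx_rotated_proj]. *)
Definition rotated_proj (c s : K) : 'M[K]_d :=
  rotated_state c s *m (rotated_state c s)^T.

Lemma rotated_projE c s : rotated_proj c s =
  (c * c) *: E i0 i0 + (c * s) *: (E i0 i1 + E i1 i0) + (s * s) *: E i1 i1.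
Proof.
rewrite /rotated_proj trmx_rotated_state /rotated_state.
rewrite !(mulmxDl, mulmxDr) -!(scalemxAl, scalemxAr) !mul_delta_mx.
move: (E i0 i0) (E i0 i1) (E i1 i0) (E i1 i1) => A B D F.
by apply/matrixP => i j; rewrite !mxE; ring.
Qed.

(** Both projections have trace 1 on the plane, so their difference is symmetric and traceless,
    hence a multiple of a reflection. Squares of such differences are then multiples of
    [level_proj]. *)
Lemma rotated_proj_diff c s : c ^+ 2 + s ^+ 2 = 1 ->
  rotated_proj c s - rotated_proj 1 0 = s *: level_refl (- s) c.
Proof.
move=> cs; rewrite !rotated_projE /level_refl.
have -> : c * c = 1 - s * s by rewrite -cs; ring.
move: (E i0 i0) (E i0 i1) (E i1 i0) (E i1 i1) => A B D F.
by apply/matrixP => i j; rewrite !mxE; ring.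
Qed.

Lemma rotated_state_norm c s : c ^+ 2 + s ^+ 2 = 1 ->
  (rotated_state c s)^T *m rotated_state c s = 1%:M.
Proof.
move=> cs; rewrite trmx_rotated_state /rotated_state.
rewrite !(mulmxDl, mulmxDr) -!(scalemxAl, scalemxAr) !mul_delta_mx_cond.
rewrite !eqxx !level_neqE !mulr0n !mulr1n.
rewrite !scaler0 addr0 add0r !scalerA -scalerDl -!expr2 cs scale1r.
by apply/matrixP => i j; rewrite !ord1 !mxE.
Qed.

Lemma trmx_level_refl a b : (level_refl a b)^T = level_refl a b.
Proof.
apply/matrixP => i j; rewrite !mxE [(j == i0) && _]andbC [(j == i1) && _]andbC.
by rewrite [(j == i0) && _]andbC [(j == i1) && _]andbC; ring.
Qed.

Lemma trmx_level_proj : level_proj^T = level_proj.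
Proof. by rewrite /level_proj linearD /= !trmx_delta. Qed.

(* The observable [level_refl 0 1] is the Pauli matrix X on the two levels. *)
Lemma mxtrace_level_refl_proj c s :
  \tr (level_refl 0 1 *m rotated_proj c s) = 2 * (c * s).
Proof.
rewrite rotated_projE /level_refl scale0r add0r scale1r.
rewrite !(mulmxDl, mulmxDr) -!scalemxAr !mulmxDr !mul_delta_mx_cond.
rewrite !eqxx !level_neqE !mulr0n !mulr1n.
have tr k l : \tr (E k l) = (k == l)%:R.
  rewrite /mxtrace (bigD1 k) //= big1 ?addr0 => [|m /negbTE mk].
    by rewrite mxE eqxx.
  by rewrite mxE mk.
rewrite !(mxtraceD, mxtraceZ, mxtrace0, tr) !eqxx !level_neqE /=.
by rewrite !mulr0n !mulr1n; ring.
Qed.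

(** A reflection on the plane extended by the identity. It is its own inverse and maps the basis
    vector [i0] to the rotated state, so its columns give an explicit eigenbasis. *)
Definition level_rotation (c s : K) : 'M[K]_d :=
  1%:M - level_proj + level_refl c s.

Lemma level_rotation_sq c s : c ^+ 2 + s ^+ 2 = 1 ->
  level_rotation c s *m level_rotation c s = 1%:M.
Proof.
move=> cs; move: level_projM (level_proj_refl c s) (level_refl_proj c s).
rewrite /level_rotation; move: (level_refl_sq cs).
move: level_proj (level_refl c s) => X Y YY XX XY YX.
rewrite !(mulmxDl, mulmxDr, mulNmx, mulmxN) !mulmx1 !mul1mx XX XY YX YY.
by apply/matrixP => i j; rewrite !mxE; ring.
Qed.

Lemma level_rotation_state c s :
  level_rotation c s *m delta_mx i0 0 = rotated_state c s.
Proof.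
rewrite /level_rotation /level_proj /level_refl /rotated_state.
rewrite !(mulmxDl, mulNmx, mul1mx) -!scalemxAl !(mulmxDl, mulNmx).
rewrite !mul_delta_mx_cond !eqxx !level_neqE !mulr0n !mulr1n.
by apply/matrixP => i j; rewrite !mxE; ring.
Qed.

End LevelAlgebra.

(** * The two levels over the complex numbers: states, projections, observable *)

Section ComplexLevels.
Variables (R : realType) (d : nat) (i0 i1 : 'I_d).
Hypothesis i01 : i0 != i1.
Local Notation C := R[i].
Local Notation "x %:RC" := (x%:C : C) (at level 2, format "x %:RC").
Local Notation P := (level_proj C i0 i1).
Local Notation T a b := (level_refl i0 i1 a%:RC b%:RC).
Local Notation state c s := (rotated_state i0 i1 c%:RC s%:RC).
Local Notation proj c s := (rotated_proj i0 i1 c%:RC s%:RC).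

Lemma unit_circleC (c s : R) : c ^+ 2 + s ^+ 2 = 1 -> c%:RC ^+ 2 + s%:RC ^+ 2 = 1.
Proof. by move=> cs; rewrite -!rmorphXn -rmorphD cs rmorph1. Qed.

Lemma adjmx_level_refl (a b : R) : (T a b)^t* = T a b.
Proof.
rewrite trmx_level_refl /level_refl map_mxD !map_mxZ map_mxB map_mxD.
by rewrite !map_delta_mx /= !conj_realC.
Qed.

Lemma adjmx_rotated_state (c s : R) : (state c s)^t* = (state c s)^T.
Proof.
by rewrite trmx_rotated_state map_mxD !map_mxZ !map_delta_mx /= !conj_realC.
Qed.

Lemma adjmx_rotated_proj (c s : R) :
  state c s *m (state c s)^t* = proj c s.
Proof. by rewrite adjmx_rotated_state. Qed.

Lemma level_proj_orthoproj : orthoproj P.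
Proof.
split; last exact: level_projM.
by rewrite trmx_level_proj /level_proj map_mxD !map_delta_mx.
Qed.

Lemma adjmx_level_rotation (c s : R) :
  (level_rotation i0 i1 c%:RC s%:RC)^t* = level_rotation i0 i1 c%:RC s%:RC.
Proof.
have [Ph _] := level_proj_orthoproj; have := adjmx_level_refl c s.
rewrite /level_rotation; move: (level_refl _ _ _ _) => X Xh.
by rewrite adjmxD adjmxD adjmxN adjmx1 Ph Xh.
Qed.

Lemma weight_level_proj : weight P = 2.
Proof.
have trE k : \tr (delta_mx k k : 'M[C]_d) = 1.
  rewrite /mxtrace (bigD1 k) //= big1 ?addr0 => [|m /negbTE mk].
    by rewrite mxE eqxx.
  by rewrite mxE mk.
by rewrite /weight /level_proj mxtraceD !trE.
Qed.

Lemma rotated_proj_orthoproj (c s : R) : c ^+ 2 + s ^+ 2 = 1 ->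
  orthoproj (proj c s).
Proof.
move=> /unit_circleC cs; split.
  by rewrite -adjmx_rotated_proj adjmxM trmxCK.
rewrite /rotated_proj mulmxA -[X in X *m _]mulmxA.
by rewrite (rotated_state_norm i01 cs) mulmx1.
Qed.

Lemma weight_rotated_proj (c s : R) : c ^+ 2 + s ^+ 2 = 1 ->
  weight (proj c s) = 1.
Proof.
move=> /unit_circleC cs; rewrite /rotated_proj weight_mulC.
by rewrite (rotated_state_norm i01 cs) /weight mxtrace1.
Qed.

(* [level_proj - T] is a multiple of its own square, for any reflection [T]. *)
Lemma rotated_proj_le (c s : R) : 0 <= s -> c ^+ 2 + s ^+ 2 = 1 ->
  psd (proj 1 0 + s%:RC *: P - proj c s).
Proof.
move=> s0 cs; have [Ph PP] := level_proj_orthoproj.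
have := rotated_proj_diff i0 i1 (unit_circleC cs).
have cs' : (- s) ^+ 2 + c ^+ 2 = 1 by rewrite sqrrN addrC.
have := adjmx_level_refl (- s) c; have := level_refl_sq i01 (unit_circleC cs').
have := level_proj_refl i01 (- s)%:RC c%:RC.
have := level_refl_proj i01 (- s)%:RC c%:RC.
rewrite !rmorphN rmorph1 rmorph0.
move: (level_refl _ _ _ _) => X XP PX XX Xh diff.
have -> : proj c s = rotated_proj i0 i1 1 0 + s%:RC *: X by rewrite -diff addrC subrK.
have -> : rotated_proj i0 i1 1 0 + s%:RC *: P - (rotated_proj i0 i1 1 0 + s%:RC *: X)
    = (s / 2)%:RC *: ((P - X) *m (P - X)^t*).
  rewrite adjmxD adjmxN Ph Xh mulmxBr !mulmxBl PP XX PX XP.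
  rewrite rmorphM fmorphV rmorph_nat /=.
  move: (rotated_proj _ _ _ _) P {Ph PP PX XP XX Xh diff} => Y Q.
  by apply/matrixP => i j; rewrite !mxE; field.
by apply: psdZ; [rewrite lecR divr_ge0 | exact: psd_gram].
Qed.

(** [U' - U] is -z s times a reflection by [rotated_proj_diff], and that reflection squares to
    [level_proj]. *)
Lemma rotated_compl_diff_sq (c s : R) (z : C) (U U' : 'M[C]_d) :
  c ^+ 2 + s ^+ 2 = 1 ->
  U = 1%:M + z *: (1%:M - proj 1 0) -> U' = 1%:M + z *: (1%:M - proj c s) ->
  (U' - U)^t* *m (U' - U) = (z^* * z * (s ^+ 2)%:RC) *: P.
Proof.
move=> cs -> ->.
have cs' : (- s) ^+ 2 + c ^+ 2 = 1 by rewrite sqrrN addrC.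
have := level_refl_sq i01 (unit_circleC cs').
have := adjmx_level_refl (- s) c; have := rotated_proj_diff i0 i1 (unit_circleC cs).
rewrite rmorphN rmorph1 rmorph0.
move: (level_refl _ _ _ _) (rotated_proj _ _ 1 0) (proj c s) => X Y Y' diff Xh XX.
have -> : 1%:M + z *: (1%:M - Y') - (1%:M + z *: (1%:M - Y)) = (- z * s%:RC) *: X.
  rewrite -scalerA -diff; move: (1%:M : 'M[C]_d) => I.
  by apply/matrixP => i j; rewrite !mxE; ring.
rewrite adjmxZ -scalemxAl -scalemxAr Xh XX scalerA; congr (_ *: _).
by rewrite rmorphM rmorphN /= conj_realC rmorphXn /=; ring.
Qed.

Definition level_observable : 'M[C]_d := level_refl i0 i1 0 1.

Lemma adjmx_level_observable : level_observable^t* = level_observable.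
Proof. by have := adjmx_level_refl 0 1; rewrite rmorph0 rmorph1. Qed.

Lemma level_observable_herm : level_observable \is hermsymmx.
Proof.
by apply/is_hermitianmxP; rewrite expr0 scale1r adjmx_level_observable.
Qed.

(** The observable squares to a projection, which is at most 1, so it does not lengthen vectors. *)
Lemma level_observable_opnorm : opnorm level_observable <= 1.
Proof.
have AA : level_observable *m level_observable = P.
  by rewrite level_refl_sq // expr0n expr1n add0r.
apply: ge_sup => [|_ [v /= v1 <-]].
  exists (l2norm (level_observable *m 0)); exists 0 => //=.
  by rewrite /l2norm mulmx0 mxE /= sqrtr0.
apply: le_trans v1; rewrite /l2norm ler_sqrt.
  rewrite adjmxM mulmxA -[X in X *m v]mulmxA adjmx_level_observable AA.
  have := orthoproj_psd (orthoproj_compl level_proj_orthoproj) v.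
  rewrite mulmxBr mulmx1 mulmxBl mxE [X in 0 <= _ + X]mxE subr_ge0.
  by rewrite lecE => /andP[].
by have := psd1 v; rewrite mulmx1 lecE => /andP[].
Qed.

Lemma level_observable_expectation (c s : R) :
  Defs.expectation level_observable (state c s) = 2 * (c * s).
Proof.
rewrite /Defs.expectation adjmx_rotated_state -trace_mx11 mxtrace_mulC mulmxA.
rewrite mxtrace_mulC mxtrace_level_refl_proj //.
by rewrite -rmorphM -(rmorph_nat (real_complex R)) -rmorphM.
Qed.

End ComplexLevels.

(** * The family of gapped Hamiltonians and their evolutions *)

Section RotatedHamiltonian.
Variables (R : realType) (n : nat) (i1 : 'I_(2 ^ n)) (Delta : R).
Hypotheses (i1E : i1 = 1%N :> nat) (Delta_gt0 : 0 < Delta).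
Local Notation C := R[i].
Local Notation i0 := (ord_ground n).
Local Notation "x %:RC" := (x%:C : C) (at level 2, format "x %:RC").
Local Notation state c s := (rotated_state i0 i1 c%:RC s%:RC).
Local Notation proj c s := (rotated_proj i0 i1 c%:RC s%:RC).

Lemma level_neq : i0 != i1.
Proof. by rewrite -val_eqE /= i1E. Qed.

Definition rotated_hamiltonian (c s : R) : 'M[C]_(2 ^ n) :=
  Delta%:RC *: (1%:M - proj c s).

Lemma rotated_hamiltonian_gapped (c s : R) : c ^+ 2 + s ^+ 2 = 1 ->
  gapped Delta (rotated_hamiltonian c s) (state c s).
Proof.
move=> cs; have h01 := level_neq.
have GG := level_rotation_sq h01 (unit_circleC cs).
have Gh := adjmx_level_rotation h01 c s.
have Gpsi := level_rotation_state h01 c%:RC s%:RC.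
move: (level_rotation _ _ _ _) GG Gh Gpsi => G GG Gh Gpsi.
(* The eigenvectors are the columns of the self-inverse [G]; column [i0] is the rotated state. *)
pose psi j : 'cV[C]_(2 ^ n) := G *m delta_mx j 0.
have psih j : (psi j)^t* = delta_mx 0 j *m G.
  by rewrite /psi adjmxM Gh trmx_delta map_delta_mx.
have psiE j : psi j *m (psi j)^t* = G *m delta_mx j j *m G.
  by rewrite psih /psi -[LHS]mulmxA (mulmxA (delta_mx j 0)) mul_delta_mx mulmxA.
have sum1 : \sum_j psi j *m (psi j)^t* = 1%:M.
  under eq_bigr do rewrite psiE.
  by rewrite -mulmx_suml -mulmx_sumr -mx1_sum_delta mulmx1 GG.
exists (fun j => if j == i0 then 0 else Delta), psi; split.
- split.
  + move=> j k; rewrite psih /psi mulmxA -[X in X *m _]mulmxA GG mulmx1.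
    by rewrite mul_delta_mx_cond; case: (j == k); rewrite !mxE.
  + rewrite /rotated_hamiltonian -sum1 (bigD1 i0) //= [RHS](bigD1 i0) //= ?eqxx.
    have -> : psi i0 *m (psi i0)^t* = proj c s.
      by rewrite /psi Gpsi adjmx_rotated_proj.
    rewrite scale0r add0r [proj c s + _]addrC addrK scaler_sumr.
    by apply: eq_bigr => j /negbTE ->.
  + move=> j k jk; case: eqP => [_|/eqP jn0]; case: eqP => [k0|_] //.
      exact: ltW.
    by move: jk jn0; rewrite k0 leqn0 -val_eqE /= => /eqP ->.
- exact: Gpsi.
- by move=> j /negbTE jn0; rewrite eqxx jn0.
- by move=> j j1; rewrite eqxx subr0 -val_eqE /= j1.
Qed.

Lemma rotated_evolutionE (c s : R) b t : c ^+ 2 + s ^+ 2 = 1 ->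
  evolution (rotated_hamiltonian c s) b t =
  1%:M + (cis ((if b then t else - t) * Delta) - 1) *: (1%:M - proj c s).
Proof.
move=> cs; rewrite /evolution /rotated_hamiltonian scalerA mulrAC -rmorphM.
have [_ QQ] := orthoproj_compl (rotated_proj_orthoproj level_neq cs).
exact: (expmx_scale_idem QQ (cvg_cis _)).
Qed.

(** For a projection [Q] and |z| = 1, the product of 1 + (z - 1) Q with its adjoint is 1 + (|z|^2 -
    1) Q = 1. *)
Lemma rotated_unitary_evolution (c s : R) : c ^+ 2 + s ^+ 2 = 1 ->
  unitary_evolution (rotated_hamiltonian c s).
Proof.
move=> cs b t; rewrite rotated_evolutionE //.
have := orthoproj_compl (rotated_proj_orthoproj level_neq cs).
move: (1%:M - _) => Q [Qh QQ]; have := cis_conjM ((if b then t else - t) * Delta).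
move: (cis _) => z zz; apply/unitarymxP; rewrite adjmxD adjmxZ adjmx1 Qh.
rewrite mulmxDl !mulmxDr -!scalemxAl -!scalemxAr !mulmx1 mul1mx QQ.
rewrite rmorphB rmorph1 scalerA -addrA -!scalerDl.
rewrite [X in X *: Q](_ : _ = z^* * z - 1); last by ring.
by rewrite zz subrr scale0r addr0.
Qed.

Lemma rotated_evolution_distance (c s sigma : R) : c ^+ 2 + s ^+ 2 = 1 ->
  0 <= s -> s <= sigma ->
  evolution_distance_le (Delta * sigma) (level_proj C i0 i1)
    (rotated_hamiltonian 1 0) (rotated_hamiltonian c s).
Proof.
move=> cs s0 ssig b t t0.
have cs10 : (1 : R) ^+ 2 + 0 ^+ 2 = 1 by rewrite expr1n expr0n addr0.
have xE : `|(if b then t else - t) * Delta| = t * Delta.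
  by rewrite normrM (gtr0_norm Delta_gt0); case: b; rewrite ?normrN ger0_norm.
have := rotated_compl_diff_sq level_neq cs
  (rotated_evolutionE b t cs10) (rotated_evolutionE b t cs).
move: (_ * Delta) xE (evolution _ _ _ - evolution _ _ _) => x xE D ->.
(* Chord |e^{ix} - 1| times [s], where |x| = [Delta * t]. Bounding [s] by [sigma] lets one rate
   serve every rotation. *)
exists (`|2 * sin (x / 2)| * s); split; first by rewrite mulr_ge0.
  have -> : Delta * sigma * t = `|x| * sigma by rewrite xE; ring.
  apply: ler_pM => //; rewrite normrM.
  apply: (le_trans (ler_wpM2l _ (norm_sin_le _))) => //.
  by rewrite -normrM mulrC divfK.
rewrite exprMn real_normK ?num_real // cis_sub1_normsq.
by rewrite [in RHS]rmorphM.
Qed.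

End RotatedHamiltonian.

(** * Half angles: the rotation with a prescribed expectation *)

Section HalfAngle.
Variable R : realType.

(** For x = sin theta with theta in [0, pi/2], these are cos (theta/2) and sin (theta/2). *)
Definition half_cos (x : R) : R := Num.sqrt ((1 + Num.sqrt (1 - x ^+ 2)) / 2).
Definition half_sin (x : R) : R := Num.sqrt ((1 - Num.sqrt (1 - x ^+ 2)) / 2).

Lemma half_angleP (x : R) : 0 <= x <= 1 ->
  [/\ half_cos x ^+ 2 + half_sin x ^+ 2 = 1,
      2 * (half_cos x * half_sin x) = x & 0 <= half_sin x <= x].
Proof.
move=> /andP[x0 x1]; rewrite /half_cos /half_sin.
have x2 : x ^+ 2 <= 1 by rewrite expr_le1.
have y2 : Num.sqrt (1 - x ^+ 2) ^+ 2 = 1 - x ^+ 2 by rewrite sqr_sqrtr ?subr_ge0.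
have y0 : 0 <= Num.sqrt (1 - x ^+ 2) by exact: sqrtr_ge0.
have y1 : Num.sqrt (1 - x ^+ 2) <= 1.
  by rewrite -(expr_le1 (n := 2)) // y2 lerBlDr lerDl sqr_ge0.
move: (Num.sqrt (1 - x ^+ 2)) y2 y0 y1 => y y2 y0 y1.
have c0 : 0 <= (1 + y) / 2 by lra.
have s0 : 0 <= (1 - y) / 2 by lra.
split.
- by rewrite !sqr_sqrtr //; field.
- rewrite -sqrtrM //; have -> : (1 + y) / 2 * ((1 - y) / 2) = (x / 2) ^+ 2.
    by rewrite expr_div_n -[x ^+ 2](subKr 1) -y2; field.
  by rewrite sqrtr_sqr ger0_norm; [field | lra].
(* With y = cos theta >= 0, the squared bound reads (1 - y) / 2 <= (1 - y) (1 + y). *)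
- rewrite sqrtr_ge0 /= -[leRHS](ger0_norm x0) -sqrtr_sqr ler_sqrt ?sqr_ge0 //.
  nra.
Qed.

End HalfAngle.

(** * Comparison with the unrotated instance and the final count *)

Lemma rotated_output_prob_within_le (R : realType) (n : nat) (i1 : 'I_(2 ^ n))
    (Delta c s sigma B : R) S N (alg : algorithm R n (2 ^ n)) :
  i1 = 1%N :> nat -> 0 < Delta -> c ^+ 2 + s ^+ 2 = 1 -> 0 <= s -> s <= sigma ->
  Delta * sigma * B <= 1 ->
  total_time_within (rotated_hamiltonian i1 Delta 1 0) N alg
    (rotated_proj (ord_ground n) i1 (1 : R)%:C (0 : R)%:C) <= B ->
  output_prob_within (rotated_hamiltonian i1 Delta c s) S N alg
    (rotated_proj (ord_ground n) i1 c%:C s%:C) <=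
  output_prob_within (rotated_hamiltonian i1 Delta 1 0) S N alg
    (rotated_proj (ord_ground n) i1 (1 : R)%:C (0 : R)%:C) +
  (2 * s + 3 * (Delta * sigma * B)).
Proof.
move=> i1E D0 cs s0 ssig kB TB; have i01 := level_neq i1E.
have cs0 : (1 : R) ^+ 2 + 0 ^+ 2 = 1 by rewrite expr1n expr0n addr0.
have u0 := rotated_unitary_evolution Delta i1E cs0.
have u1 := rotated_unitary_evolution Delta i1E cs.
have k0 := mulr_ge0 (ltW D0) (le_trans s0 ssig).
have dist := rotated_evolution_distance i1E D0 cs s0 ssig.
have oP := level_proj_orthoproj R i01.
have s0C : (0 : R[i]) <= s%:C by rewrite lecR.
have pQ := psdZ s0C (orthoproj_psd oP).
have p0 := orthoproj_psd (rotated_proj_orthoproj i01 cs0).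
have p1 := orthoproj_psd (rotated_proj_orthoproj i01 cs).
have le01 := rotated_proj_le i01 s0 cs.
(* The initial error is [s] times [level_proj], of weight 2 s: the input copies differ as well as
   the evolutions. *)
have := output_prob_within_hybrid S u0 u1 oP k0 dist p0 p1 pQ le01 kB TB.
rewrite (weight_rotated_proj i01 cs0) mulr1 weightZ weight_level_proj.
by rewrite -addrA (mulrC s).
Qed.

(** The supremum over step counts need not be attained, so only a value strictly below it is reached
    in finitely many steps. *)
Lemma output_prob_gt (R : realType) (n d : nat) (H : 'M[R[i]]_(2 ^ n))
    (S : set R) (alg : algorithm R n d) rho (q : R) :
  q < output_prob H S alg rho ->
  exists N, q < output_prob_within H S N alg rho.
Proof.
move=> qS; apply: contrapT => /forallNP noN; move: qS; apply/negP; rewrite -leNgt.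
apply: ge_sup; first by exists (output_prob_within H S 0 alg rho); exists 0%N.
by move=> _ [N _ <-]; rewrite leNgt; apply/negP; exact: noN.
Qed.

Theorem mainTheorem3 (R : realType) (p : R) (p_gt0 : 0 < p) (p_lt1 : p < 1) :
  exists c eps0 : R, 0 < c /\ 0 < eps0 /\
    forall (n : nat) (Delta eps : R),
      (1 <= n)%N -> 0 < Delta -> 0 < eps -> eps <= eps0 ->
      forall alg : 'M[R[i]]_(2 ^ n) -> algorithm R n (2 ^ n),
        estimates Delta eps p alg ->
        exists (H : 'M[R[i]]_(2 ^ n)) (psi0 : 'cV[R[i]]_(2 ^ n))
          (A : 'M[R[i]]_(2 ^ n)),
          [/\ gapped Delta H psi0, A \is hermsymmx, opnorm A <= 1 &
              ((c / (Delta * eps))%:E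
                 <= total_time H (alg A) (psi0 *m psi0 ^t* ))%E].
Proof.
have [K Kp] : exists K : nat, 2 < K%:R * p.
  exists (Num.bound (2 / p)); rewrite -ltr_pdivrMr //.
  by apply: archi_boundP; rewrite divr_ge0 // ltW.
have K0 : (0 : R) < K%:R.
  by rewrite ltr0n lt0n; apply: contraTneq Kp => ->; rewrite mul0r -leNgt.
(* As both [c] and [eps0], this value gives [sigma <= 3 * p / 200] and
   [Delta * sigma * B = 3 * p / 200] below. *)
pose c0 : R := p / (200 * K%:R).
have c0_gt0 : 0 < c0 by rewrite divr_gt0 // mulr_gt0.
have c0K : c0 * K%:R = p / 200 by rewrite /c0; field; rewrite gt_eqF.
exists c0, c0; split=> //; split=> // n Delta eps n1 D0 e0 ec alg algE.
have two_le : (1 < 2 ^ n)%N by rewrite -{1}(expn0 2) ltn_exp2l.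
pose i1 : 'I_(2 ^ n) := Ordinal two_le.
have i1E : i1 = 1%N :> nat by [].
have i01 : ord_ground n != i1 by exact: level_neq.
pose A := level_observable R (ord_ground n) i1.
pose state (c s : R) := rotated_state (ord_ground n) i1 c%:C s%:C.
pose ham (c s : R) := rotated_hamiltonian i1 Delta c s.
pose proj (c s : R) := rotated_proj (ord_ground n) i1 c%:C s%:C.
have projE c s : state c s *m (state c s)^t* = proj c s.
  exact: adjmx_rotated_proj.
have cs0 : (1 : R) ^+ 2 + 0 ^+ 2 = 1 by rewrite expr1n expr0n addr0.
pose x_ (j : 'I_K) : R := 3 * eps * j%:R.
pose sigma : R := 3 * eps * K%:R.
have sigma_le : sigma <= 3 * p / 200.
  have : eps * K%:R <= c0 * K%:R by rewrite ler_wpM2r // ltW.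
  by rewrite c0K /sigma; lra.
have e3 : 0 <= 3 * eps by rewrite mulr_ge0 // ltW.
have x_range j : 0 <= x_ j <= 1.
  apply/andP; split; first by rewrite mulr_ge0.
  apply: (@le_trans _ _ sigma); last by move: sigma_le; lra.
  by rewrite ler_wpM2l // ler_nat ltnW.
have x_sigma j : x_ j <= sigma.
  by rewrite ler_wpM2l // ler_nat ltnW.
(* Only the time on the unrotated instance is bounded. All instances share [A], hence the same
   strategy [alg A]. *)
exists (ham 1 0), (state 1 0), A; split.
- exact: rotated_hamiltonian_gapped.
- exact: level_observable_herm.
- exact: level_observable_opnorm.
rewrite leNgt; apply/negP => T_lt.
set B := c0 / (Delta * eps) in T_lt.
rewrite projE in T_lt.
have TB N : total_time_within (ham 1 0) N (alg A) (proj 1 0) <= B.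
  rewrite -lee_fin; apply: le_trans (ltW T_lt).
  by apply: ereal_sup_ubound; exists N.
have kB : Delta * sigma * B = 3 * p / 200.
  have -> : Delta * sigma * B = 3 * (c0 * K%:R).
    by rewrite /B /sigma; field; rewrite !gt_eqF.
  by rewrite c0K mulrA.
pose S_ j := [set a : R | `|a - x_ j| <= eps].
pose out0 N j := output_prob_within (ham 1 0) (S_ j) N (alg A) (proj 1 0).
have hit j : exists N, 3 / 4 * p < out0 N j.
  have [cs cs2 /andP[s0 sx]] := half_angleP (x_range j).
  have := algE _ _ A (rotated_hamiltonian_gapped i1E D0 cs)
    (level_observable_herm _ _ _) (level_observable_opnorm _ i01).
  rewrite projE level_observable_expectation // cs2 => pS.
  (* From [p] to 7p/8 for truncation to [N] steps, then to 3p/4 for the comparison, which loses at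
     most 2 sigma + 9p/200 <= 15p/200 < p/8. *)
  have p78 : 7 / 8 * p < p by move: p_gt0; lra.
  have [N NP] := output_prob_gt (lt_le_trans p78 pS); exists N.
  have ss := le_trans sx (x_sigma j).
  have kB1 : Delta * sigma * B <= 1 by rewrite kB; move: p_lt1; lra.
  have := rotated_output_prob_within_le (S_ j) i1E D0 cs s0 ss kB1 (TB N).
  move/(lt_le_trans NP); rewrite kB -/(out0 N j).
  by move: ss sigma_le p_gt0; lra.
have [N_ hitN] := choice hit.
(* A common step count, so that all events belong to one truncated run. *)
pose N := (\max_j N_ j)%N.
have disj i j a : S_ i a -> S_ j a -> i = j.
  rewrite /S_ /= => Si Sj; apply: val_inj; apply/eqP; apply: contraT => ij.
  have : `|x_ i - x_ j| <= 2 * eps.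
    have -> : x_ i - x_ j = (a - x_ j) - (a - x_ i) by ring.
    by rewrite (le_trans (ler_normB _ _)) // mulrDl mul1r lerD.
  rewrite /x_ -mulrBr normrM (gtr0_norm (_ : 0 < 3 * eps)) ?mulr_gt0 //.
  (* Distinct integers differ by at least 1, so the centres are 3 eps apart, against the 2 eps that
     a common estimate allows. *)
  have : (1 : R) <= `|i%:R - j%:R|.
    rewrite -[_%:R]/((i : int)%:~R) -[j%:R]/((j : int)%:~R) -rmorphB -intr_norm.
    by rewrite ler1z -gtz0_ge1 normr_gt0 subr_eq0.
  move=> h1 h2; have := ler_wpM2l (ltW (mulr_gt0 (ltr0n R 3) e0)) h1.
  by move: h2 e0; lra.
have := sum_output_prob_within_le N (alg A)
  (rotated_unitary_evolution Delta i1E cs0) disj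
  (orthoproj_psd (rotated_proj_orthoproj i01 cs0)).
rewrite (weight_rotated_proj i01 cs0) leNgt => /negP; apply.
(* Since K p > 2, the disjoint events would have total probability above 3/2. *)
apply: (@lt_le_trans _ _ (\sum_(j < K) (3 / 4 * p))).
  by rewrite sumr_const card_ord -mulr_natl; move: Kp; lra.
apply: ler_sum => j _; apply: (le_trans (ltW (hitN j))).
apply: output_prob_within_nondecreasing; last exact: leq_bigmax.
exact (orthoproj_psd (rotated_proj_orthoproj i01 cs0)).
Qed.
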